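(* Let $\mathfrak S\subset\mathbb R^s$ be compact. Let $B\in\mathbb R^{n\times m}$ and let $Q\colon\mathbb R^n\to H_Q$ be a bounded linear operator into a Hilbert space $H_Q$. For each $\sigma\in\mathfrak S$ let $\mathcal A_\sigma\in L^\infty((0,+\infty);\mathbb R^{n\times n})$ be time-periodic with period $\rho(\sigma)>0$. Assume that: (i) for every $\sigma\in\mathfrak S$, the pair $(\mathcal A_\sigma,B)$ is exponentially stabilizable and the pair $(\mathcal A_\sigma,Q)$ is exponentially detectable; (ii) the map $\sigma\mapsto\mathcal A_\sigma$ is continuous from $\mathfrak S$ into $L^\infty((0,+\infty);\mathbb R^{n\times n})$; (iii) for every $\sigma\in\mathfrak S$, let $\Pi_\sigma$ be the $\rho(\sigma)$-periodic, symmetric positive semidefinite solution in $L^\infty((0,+\infty);\mathbb R^{n\times n})$ of the Riccati equation $$\dot\Pi_\sigma+\mathcal A_\sigma^*\Pi_\sigma+\Pi_\sigma\mathcal A_\sigma-\Pi_\sigma BB^*\Pi_\sigma+Q^*Q=0,\qquad \Pi_\sigma(t+\rho(\sigma))=\Pi_\sigma(t);$$ this $\Pi_\sigma$ depends continuously (in the $L^\infty$-norm) on $\sigma\in\mathfrak S$, and there exist $D\ge1$ and $\lambda>0$ such that for all $\sigma\in\mathfrak S$ the operator $\mathcal A_\sigma-BB^\top\Pi_\sigma$ is $(D,\lambda)$-stable. Then there exists $\varepsilon>0$ such that for every $(\sigma,\varsigma)\in\mathfrak S\times\mathfrak S$ with $|\sigma-\varsigma|<\varepsilon$, the operator $\mathcal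 A_\sigma-BB^\top\Pi_\varsigma$ is exponentially stable.
   Context: Here $n,m,s$ are positive integers, $|\cdot|$ denotes the Euclidean norm, and $D^*$ (or $D^\top$ for a matrix) denotes the adjoint of an operator $D$. The matrix-valued function $\mathcal A_\sigma$ defines the free dynamics $\dot y=\mathcal A_\sigma(t)y$ of a linear control system $\dot y=\mathcal A_\sigma y+Bu$ depending on a parameter $\sigma$. Definitions. Let $\zeta\ge1$ and $\mu>0$. A time-dependent operator $M\in L^\infty((0,+\infty);\mathbb R^{n\times n})$ is $(\zeta,\mu)$-stable if, for every $y_0\in\mathbb R^n$, the solution of $\dot y=M(t)y$, $y(0)=y_0$, satisfies $$|y(t)|\le\zeta e^{-\mu(t-s)}|y(s)|\quad\text{for all } t\ge s\ge0.$$ It is exponentially stable if it is $(\zeta,\mu)$-stable for some $\zeta\ge1$ and $\mu>0$. The pair $(\mathcal A_\sigma,B)$ is exponentially stabilizable if there is $K\in L^\infty((0,+\infty);\mathbb R^{m\times n})$ such that $\mathcal A_\sigma+BK$ is exponentially stable. The pair $(\mathcal A_\sigma,Q)$ is exponentially detectable if there is $L\in L^\infty((0,+\infty);\mathcal L(H_Q,\mathbb R^n))$ such that $\mathcal A_\sigma+LQ$ is exponentially stable, where $\mathcal L(X,Y)$ denotes the bounded linear operators from $X$ to $Y$. *)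

(* Defs.v *)
From HB Require Import structures.
From mathcomp Require Import all_boot all_order all_algebra.
From mathcomp Require Import all_classical all_reals all_analysis.

Set Implicit Arguments.
Unset Strict Implicit.
Unset Printing Implicit Defensive.
Import Order.TTheory GRing.Theory Num.Theory.
Import numFieldNormedType.Exports.

Local Open Scope classical_set_scope.
Local Open Scope ring_scope.

(* The norm that MathComp-Analysis puts on matrices is the maximum norm, so the
   Euclidean norm of a (row or column) vector has to be introduced. *)
Definition enorm (R : realType) (p q : nat) (x : 'M[R]_(p, q)) : R :=
  Num.sqrt (\sum_i \sum_j x i j ^+ 2).

(* L^oo((0,+oo); R^(p x q)). Elements are represented by functions on R of which
   only the values on (0,+oo), up to null sets, matter. [`|M t|] is the maximum
   norm; any other choice gives the same space with an equivalent norm. *)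
Definition Linfty_norm (R : realType) (p q : nat) (M : R -> 'M[R]_(p, q)) :
    \bar R :=
  Lnorm (@lebesgue_measure R) +oo%E
    ((fun t => `|M t|%:E) \_ (`]0, +oo[ : set R)).

Definition Linfty (R : realType) (p q : nat) (M : R -> 'M[R]_(p, q)) : Prop :=
  (forall i j, measurable_fun (`]0, +oo[ : set R) (fun t => M t i j)) /\
  (Linfty_norm M < +oo)%E.

(* Continuity on [S], for the L^oo norm, of a family of elements of L^oo. *)
Definition Linfty_continuous_on (R : realType) (s p q : nat)
    (S : set 'rV[R]_s) (F : 'rV[R]_s -> R -> 'M[R]_(p, q)) : Prop :=
  forall sigma, S sigma ->
    Linfty_norm (fun t => F tau t - F sigma t)
      @[tau --> within S (nbhs sigma)] --> 0%E.

(* [X' = g] on [0,+oo[ in the sense of Caratheodory: [X] is locally absolutely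
   continuous with derivative [g] almost everywhere, i.e. it is an indefinite
   Lebesgue integral of the locally integrable function [g]. *)
Definition has_derivative (R : realType) (p q : nat)
    (X g : R -> 'M[R]_(p, q)) : Prop :=
  forall t, 0 <= t -> forall i j,
    (@lebesgue_measure R).-integrable `[0, t] (fun u => (g u i j)%:E) /\
    X t i j = X 0 i j + Rintegral (@lebesgue_measure R) `[0, t] (fun u => g u i j).

Definition solution (R : realType) (n : nat) (M : R -> 'M[R]_n)
    (y0 : 'cV[R]_n) (y : R -> 'cV[R]_n) : Prop :=
  has_derivative y (fun t => M t *m y t) /\ y 0 = y0.

Definition stable (R : realType) (n : nat) (zeta mu : R)
    (M : R -> 'M[R]_n) : Prop :=
  Linfty M /\
  forall (y0 : 'cV[R]_n) (y : R -> 'cV[R]_n), solution M y0 y ->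
  forall s t, 0 <= s -> s <= t ->
    enorm (y t) <= zeta * expR (- mu * (t - s)) * enorm (y s).

Definition exponentially_stable (R : realType) (n : nat)
    (M : R -> 'M[R]_n) : Prop :=
  exists zeta mu : R, [/\ 1 <= zeta, 0 < mu & stable zeta mu M].

Definition exponentially_stabilizable (R : realType) (n m : nat)
    (A : R -> 'M[R]_n) (B : 'M[R]_(n, m)) : Prop :=
  exists2 K : R -> 'M[R]_(m, n),
    Linfty K & exponentially_stable (fun t => A t + B *m K t).

(* [ip] is an inner product inducing the norm of [H]; together with the
   completeness of [H] this makes [H] a real Hilbert space. *)
Definition inner_product (R : realType) (H : completeNormedModType R)
    (ip : H -> H -> R) : Prop :=
  [/\ forall x y, ip x y = ip y x,
      forall (a : R) x y z, ip (a *: x + y) z = a * ip x z + ip y z &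
      forall x, `|x| ^+ 2 = ip x x].

Definition op_mx (R : realType) (p q : nat) (f : 'cV[R]_q -> 'cV[R]_p) :
    'M[R]_(p, q) :=
  \matrix_(i, j) f (delta_mx j 0) i 0.

Definition adjoint (R : realType) (H : completeNormedModType R)
    (ip : H -> H -> R) (n : nat) (Q : 'cV[R]_n -> H) : H -> 'cV[R]_n :=
  fun h => \col_i ip (Q (delta_mx i 0)) h.

Lemma adjointP (R : realType) (H : completeNormedModType R)
    (ip : H -> H -> R) (n : nat) (Q : {linear 'cV[R]_n -> H}) :
  inner_product ip ->
  forall x h, ip (Q x) h = (x^T *m adjoint ip Q h) 0 0.
Proof.
move=> [_ ipl _] x h.
have ip0 : ip 0 h = 0.
  have := ipl 1 0 0 h; rewrite scale1r addr0 mul1r => e.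
  by apply: (@addrI _ (ip 0 h)); rewrite -e addr0.
rewrite {1}(matrix_sum_delta x) linear_sum mxE.
rewrite (big_morph (ip^~ h) (id1 := 0) (op1 := +%R)) //; last first.
  by move=> u v; have := ipl 1 u v h; rewrite scale1r mul1r.
apply: eq_bigr => i _; rewrite big_ord1 linearZ /= !mxE.
by have := ipl (x i 0) (Q (delta_mx i 0)) 0 h; rewrite addr0 ip0 addr0.
Qed.

(* L^oo((0,+oo); L(H, R^n)): strongly (Bochner) measurable functions, i.e. almost
   everywhere limits of simple functions for the operator norm, that are
   essentially bounded for the operator norm. *)
Definition simple_op (R : realType) (H : completeNormedModType R) (n : nat)
    (F : R -> H -> 'cV[R]_n) : Prop :=
  exists (N : nat) (E : 'I_N -> set R) (T : 'I_N -> {linear H -> 'cV[R]_n}),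
    [/\ forall i, measurable (E i), forall i, continuous (T i) &
        forall t h, F t h = \sum_(i < N) \1_(E i) t *: T i h].

Definition strongly_measurable (R : realType) (H : completeNormedModType R)
    (n : nat) (L : R -> H -> 'cV[R]_n) : Prop :=
  exists F : nat -> R -> H -> 'cV[R]_n,
    (forall k, simple_op (F k)) /\
    {ae @lebesgue_measure R, forall t, 0 < t -> forall e : R, 0 < e ->
      \forall k \near \oo, forall h, enorm (F k t h - L t h) <= e * `|h|}.

Definition Linfty_op (R : realType) (H : completeNormedModType R) (n : nat)
    (L : R -> {linear H -> 'cV[R]_n}) : Prop :=
  [/\ forall t, 0 < t -> continuous (L t),
      strongly_measurable (fun t => L t : H -> 'cV[R]_n) &
      exists C : R, {ae @lebesgue_measure R, forall t, 0 < t ->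
        forall h, enorm (L t h) <= C * `|h|}].

Definition exponentially_detectable (R : realType) (n : nat)
    (H : completeNormedModType R) (A : R -> 'M[R]_n)
    (Q : {linear 'cV[R]_n -> H}) : Prop :=
  exists2 L : R -> {linear H -> 'cV[R]_n},
    Linfty_op L & exponentially_stable (fun t => A t + op_mx (L t \o Q)).

Definition periodic_riccati_solution (R : realType) (n m : nat)
    (H : completeNormedModType R) (ip : H -> H -> R) (A : R -> 'M[R]_n)
    (B : 'M[R]_(n, m)) (Q : {linear 'cV[R]_n -> H}) (rho : R)
    (P : R -> 'M[R]_n) : Prop :=
  [/\ Linfty P,
      forall t, 0 <= t -> P (t + rho) = P t,
      forall t, 0 <= t -> (P t)^T = P t,
      forall t, 0 <= t -> forall x : 'cV[R]_n, 0 <= (x^T *m P t *m x) 0 0 &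
      has_derivative P (fun t =>
        - ((A t)^T *m P t + P t *m A t - P t *m (B *m B^T) *m P t
           + op_mx (adjoint ip Q \o Q)))].

(* Main.v *)
(* The closed-loop operator for (sigma, varsigma) is an L^oo-small perturbation of
   the stable closed loop at any nearby point of the compact set, so it is enough
   that exponential stability of a fixed M0 survives small L^oo perturbations; a
   compactness argument then makes eps uniform. For a solution y of the perturbed
   equation and any s >= 0, let z be the solution of the unperturbed equation with
   z(s) = y(s). On a window [s, s + T] with T large, z contracts by stability, and
   by Gronwall y - z is at most a small multiple of |y(s)|; hence |y(s + T)| is at
   most |y(s)| / e, and iterating over windows gives exponential decay. Stability
   only speaks about solutions defined from time 0 on, so z has to be constructed
   on all of [0, +oo[, both forwards and backwards from s. *)
Require Import Defs.
From HB Require Import structures.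
From mathcomp Require Import all_boot all_order all_algebra.
From mathcomp Require Import all_classical all_reals all_analysis.
From mathcomp Require Import measurable_realfun ess_sup_inf lra ring.
Import Order.TTheory GRing.Theory Num.Theory.
Import numFieldNormedType.Exports.
Local Open Scope classical_set_scope.
Local Open Scope ring_scope.

Set Implicit Arguments.
Unset Strict Implicit.
Unset Printing Implicit Defensive.

Local Notation leb := (@lebesgue_measure _).

(** * Almost everywhere reasoning, the maximum norm and essential bounds *)

Lemma ae_imp (R : realType) (P Q : R -> Prop) :
  (forall t, P t -> Q t) ->
  {ae @lebesgue_measure R, forall t, P t} -> {ae @lebesgue_measure R, forall t, Q t}.
Proof. exact: (@filterS _ _ (ae_filter_ringOfSetsType (@lebesgue_measure R))). Qed.

Lemma ae_imp2 (R : realType) (P1 P2 Q : R -> Prop) :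
  (forall t, P1 t -> P2 t -> Q t) ->
  {ae @lebesgue_measure R, forall t, P1 t} ->
  {ae @lebesgue_measure R, forall t, P2 t} -> {ae @lebesgue_measure R, forall t, Q t}.
Proof. exact: (@filterS2 _ _ (ae_filter_ringOfSetsType (@lebesgue_measure R))). Qed.

Lemma mx_entry_le (R : realType) (p q : nat) (x : 'M[R]_(p, q)) i j :
  `|x i j| <= `|x|.
Proof.
by rewrite [leRHS]/Num.norm /= mx_normrE; apply/bigmax_geP; right; exists (i, j).
Qed.

Lemma mx_norm_le (R : realType) (p q : nat) (x : 'M[R]_(p, q)) c :
  0 <= c -> (forall i j, `|x i j| <= c) -> `|x| <= c.
Proof.
move=> c0 xc; rewrite [leLHS]/Num.norm /= mx_normrE.
by apply/bigmax_leP; split => // -[i j] _; exact: xc.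
Qed.

Lemma mulmx_norm_le (R : realType) (p q r : nat) (M : 'M[R]_(p, q))
    (N : 'M[R]_(q, r)) : `|M *m N| <= q%:R * `|M| * `|N|.
Proof.
apply: mx_norm_le => [|i j]; first by rewrite !mulr_ge0.
rewrite mxE (le_trans (ler_norm_sum _ _ _))//.
rewrite -mulrA mulr_natl.
have -> : `|M| * `|N| *+ q = \sum_(k < q) `|M| * `|N|.
  by rewrite sumr_const card_ord.
apply: ler_sum => k _.
by rewrite normrM ler_pM ?mx_entry_le.
Qed.

Lemma mx_norm_le_enorm (R : realType) (p q : nat) (x : 'M[R]_(p, q)) :
  `|x| <= enorm x.
Proof.
apply: mx_norm_le => [|i j]; first exact: sqrtr_ge0.
rewrite -sqrtr_sqr ler_wsqrtr// (bigD1 i)//= (bigD1 j)//= -addrA lerDl.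
by rewrite addr_ge0 ?sumr_ge0// => k _; rewrite ?sumr_ge0// => *; rewrite sqr_ge0.
Qed.

Lemma enorm_le_mx_norm (R : realType) (n : nat) (x : 'cV[R]_n) :
  enorm x <= n%:R * `|x|.
Proof.
rewrite -[leRHS]ger0_norm ?mulr_ge0// -sqrtr_sqr ler_wsqrtr//.
rewrite exprMn.
apply: (@le_trans _ _ (\sum_(i < n) `|x| ^+ 2)).
  apply: ler_sum => i _; rewrite big_ord1 -[leLHS]ger0_norm ?sqr_ge0// normrX.
  by rewrite lerXn2r ?nnegrE// mx_entry_le.
rewrite sumr_const card_ord -[leLHS]mulr_natl ler_wpM2r ?sqr_ge0//.
by rewrite -natrX ler_nat; case: n {x} => // k; rewrite -mulnn leq_pmulr.
Qed.

Definition ae_le (R : realType) (p q : nat) (M : R -> 'M[R]_(p, q)) (c : R) :=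
  {ae @lebesgue_measure R, forall t, 0 < t -> `|M t| <= c}.

(** Trades the essential supremum for a real inequality almost everywhere on []0, +oo[]. Off that
    interval the restricted function is 0, hence [0 <= c]. *)
Lemma Linfty_normP (R : realType) (p q : nat) (M : R -> 'M[R]_(p, q)) (c : R) :
  0 <= c -> (Linfty_norm M <= c%:E)%E <-> ae_le M c.
Proof.
move=> c0; rewrite /Linfty_norm unlock.
(* The unfolded norm at [+oo] is a case distinction on whether the whole space has positive
   measure. *)
have -> : (0 < (@lebesgue_measure R) [set: R])%E.
  by rewrite -set_itvNyy lebesgue_measure_itv /=; exact: ltry.
set f := _ \_ _.
have E t : ((abse \o f) t <= c%:E)%E <-> (0 < t -> `|M t| <= c).
  rewrite /= /f patchE; case: ifPn => [|].
    rewrite inE /= in_itv /= andbT => t0; rewrite normr_id lee_fin.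
    by split => [//|]; apply.
  rewrite notin_setE /= in_itv /= andbT => t0; rewrite normr0 lee_fin c0.
  by split.
split=> [/ess_supP|] H; last apply/ess_sup_inf.ess_supP.
  by apply: ae_imp H => t /E.
by apply: ae_imp H => t /E.
Qed.

Lemma LinftyP (R : realType) (p q : nat) (M : R -> 'M[R]_(p, q)) :
  Linfty M <-> (forall i j, measurable_fun (`]0, +oo[ : set R)
                              (fun t => M t i j)) /\
               exists2 c : R, 0 < c & ae_le M c.
Proof.
split=> -[mM H]; split => //; last first.
  by case: H => c c0 /(Linfty_normP _ (ltW c0)) /le_lt_trans; apply; rewrite ltry.
case E : (Linfty_norm M) H => [c|//|] _.
- exists (`|c| + 1); first by rewrite ltr_pwDr.
  apply/Linfty_normP; first by rewrite addr_ge0.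
  by rewrite E lee_fin (le_trans (ler_norm _))// lerDl.
- exists 1 => //; apply/Linfty_normP => //; by rewrite E; exact: leNye.
Qed.

(** * Calculus of Caratheodory derivatives *)

(** Each entry of the increment is an integral of an entry of [g], dominated by the integral of [f],
    which the fundamental theorem of calculus evaluates. The interval is open at [a], since for
    [a = 0] the bounds on [g] come from data controlled only on []0, +oo[]. *)
Lemma has_derivative_increment_le (R : realType) (p q : nat)
    (X g : R -> 'M[R]_(p, q)) (F f : R -> R) (a b : R) :
  has_derivative X g -> 0 <= a -> a <= b ->
  (forall r : R, is_derive r 1 F (f r)) -> continuous f -> (forall r, 0 <= f r) ->
  {ae @lebesgue_measure R, forall r, a < r -> r <= b -> `|g r| <= f r} ->
  `|X b - X a| <= F b - F a.
Proof.
move=> Xg a0; rewrite le_eqVlt => /predU1P[->|ab] dF cf f0 gf.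
  by rewrite !subrr normr0.
have mf : measurable_fun (`]a, b] : set R) f.
  by apply: measurable_funTS; exact: continuous_measurable_fun.
have intf : (\int[leb]_(x in `]a, b]) (f x)%:E = (F b - F a)%:E)%E.
  rewrite integral_itv_obnd_cbnd//; last exact/measurable_EFinP.
  rewrite (@continuous_FTC2 _ f F)//; first exact: continuous_subspaceT.
    split=> [x _||]; first by case: (dF x).
    - by apply: cvg_at_right_filter; apply: differentiable_continuous;
         apply/derivable1_diffP; case: (dF a).
    - by apply: cvg_at_left_filter; apply: differentiable_continuous;
         apply/derivable1_diffP; case: (dF b).
  by move=> x _; rewrite derive1E; apply: derive_val.
have Fab : 0 <= F b - F a.
  by rewrite -lee_fin -intf; apply: integral_ge0 => x _; rewrite lee_fin.
apply: mx_norm_le => // i j; rewrite !mxE.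
have [ig ->] := Xg b (le_trans a0 (ltW ab)) i j.
have [_ ->] := Xg a a0 i j.
rewrite opprD addrACA subrr add0r Rintegral_itvB ?bnd_simp ?(ltW ab)//.
have iab : leb.-integrable `]a, b] (EFin \o (fun u => g u i j)).
  apply: integrableS ig => // x /=; rewrite !in_itv /= => /andP[ax ->].
  by rewrite andbT ltW// (le_lt_trans a0).
rewrite (le_trans (le_normr_Rintegral _ _))//.
rewrite -lee_fin fineK; last first.
  rewrite ge0_fin_numE; last exact: integral_ge0.
  by case/integrableP : iab.
rewrite -intf; apply: ae_ge0_le_integral => //.
- have /integrableP[mg _] := iab.
  apply/measurable_EFinP; apply: measurableT_comp => //; exact/measurable_EFinP.
- by move=> x _; rewrite lee_fin.
- exact/measurable_EFinP.
- apply: ae_imp gf => x H; rewrite /= in_itv /= => /andP[ax xb].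
  by rewrite lee_fin (le_trans (mx_entry_le _ i j))// H.
Qed.

Lemma sub_mxE (V : zmodType) (p q : nat) (M N : 'M[V]_(p, q)) i j :
  (M - N) i j = M i j - N i j.
Proof. by rewrite !mxE. Qed.

Lemma has_derivativeB (R : realType) (p q : nat) (X Y g h : R -> 'M[R]_(p, q)) :
  has_derivative X g -> has_derivative Y h ->
  has_derivative (fun t => X t - Y t) (fun t => g t - h t).
Proof.
move=> Xg Yh t t0 i j; have [ig Xt] := Xg t t0 i j; have [ih Yt] := Yh t t0 i j.
split.
  apply: eq_integrable (integrableB _ ig ih) => // u _.
  exact: (congr1 EFin (esym (sub_mxE (g u) (h u) i j))).
rewrite sub_mxE Xt Yt.
have -> : \int[leb]_(u in `[0, t]) ((g u - h u) i j) =
    \int[leb]_(u in `[0, t]) (g u i j - h u i j).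
  by apply: eq_Rintegral => u _; exact: sub_mxE.
by rewrite RintegralB// sub_mxE; ring.
Qed.

Lemma eq_has_derivative (R : realType) (p q : nat) (X Y g h : R -> 'M[R]_(p, q)) :
  (forall t, 0 <= t -> X t = Y t) -> (forall t, 0 <= t -> g t = h t) ->
  has_derivative X g -> has_derivative Y h.
Proof.
move=> XY gh Xg t t0 i j; rewrite -!XY//; have [ig ->] := Xg t t0 i j.
have E u : u \in `[0, t]%classic -> g u i j = h u i j.
  by rewrite inE /= in_itv /= => /andP[u0 _]; rewrite gh.
split; last by congr (_ + _); exact: eq_Rintegral.
by apply: eq_integrable ig => // u /E ->.
Qed.

Lemma has_derivative_continuous (R : realType) (p q : nat)
    (X g : R -> 'M[R]_(p, q)) (T : R) i j :
  has_derivative X g -> 0 <= T ->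
  {within `[0, T], continuous (fun t => X t i j)}.
Proof.
move=> Xg T0; have [ig _] := Xg T T0 i j.
have c := parameterized_integral_continuous T0 ig.
apply: (@subspace_eq_continuous _ _ _ (fun t => X 0 i j +
   parameterized_integral leb 0 t (fun u => g u i j))).
  by move=> t; rewrite inE /= in_itv /= => /andP[t0 _]; exact: (esym (Xg t t0 i j).2).
apply: (within_continuousD _ c).
by apply: continuous_subspaceT => ?; exact: cst_continuous.
Qed.

Lemma has_derivative_measurable (R : realType) (p q : nat)
    (X g : R -> 'M[R]_(p, q)) (T : R) i j :
  has_derivative X g -> 0 <= T ->
  measurable_fun (`[0, T] : set R) (fun t => X t i j).
Proof.
move=> Xg T0; apply: subspace_continuous_measurable_fun => //.
exact: has_derivative_continuous Xg T0.
Qed.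

(** Entries are continuous on [[0, T]], so the extreme value theorem bounds each one; the sum of
    these bounds serves all entries. *)
Lemma has_derivative_bounded (R : realType) (p q : nat)
    (X g : R -> 'M[R]_(p, q)) (T : R) :
  has_derivative X g -> 0 <= T ->
  exists2 C : R, 0 <= C & forall t, 0 <= t -> t <= T -> `|X t| <= C.
Proof.
move=> Xg T0.
have /choice[C HC] : forall ij : 'I_p * 'I_q, exists C, forall t, 0 <= t ->
    t <= T -> `|X t ij.1 ij.2| <= C.
  move=> [i j].
  have c := has_derivative_continuous (i := i) (j := j) Xg T0.
  have [m1 _ H1] := EVT_max T0 c; have [m2 _ H2] := EVT_min T0 c.
  exists (`|X m1 i j| + `|X m2 i j|) => t t0 tT /=.
  have I : t \in `[0, T] by rewrite in_itv /= t0.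
  have h1 := ler_norm (X m1 i j); have := ler_norm (- X m2 i j).
  have k1 := normr_ge0 (X m1 i j); have k2 := normr_ge0 (X m2 i j).
  have := H1 _ I; have := H2 _ I; rewrite ler_norml normrN => *.
  by apply/andP; split; lra.
exists (\sum_ij `|C ij|); first by apply: sumr_ge0.
move=> t t0 tT; apply: mx_norm_le => [|i j]; first by apply: sumr_ge0.
rewrite (bigD1 (i, j))//= (le_trans (HC (i, j) t t0 tT))//.
by rewrite (le_trans (ler_norm _))// lerDl sumr_ge0.
Qed.

(** * Weighted integral estimates and geometric sequences *)

(** The comparison function for all increment estimates below: [b = 0] in the Picard contraction,
    [b] equal to the forcing bound in the Gronwall estimate. *)
Lemma is_derive_affine_expR (R : realType) (a k b s r : R) :
  is_derive r 1 (fun r => a * expR (k * (r - s)) + b * r)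
    (a * k * expR (k * (r - s)) + b).
Proof.
have d1 : is_derive r 1 (fun r => k * (r - s)) k.
  by apply: is_derive_eq; rewrite subr0 scaler1 /GRing.scale /=; ring.
have d2 : is_derive r 1 (fun r => expR (k * (r - s))) (k * expR (k * (r - s))).
  rewrite mulrC; exact: (@is_derive1_comp _ expR _ _ _ _ (is_derive_expR _) d1).
by apply: is_derive_eq; rewrite /GRing.scale /=; ring.
Qed.

Lemma continuous_affine_expR (R : realType) (a k b s : R) :
  continuous (fun r : R => a * expR (k * (r - s)) + b).
Proof.
move=> r; apply: cvgD; last exact: cvg_cst.
apply: cvgMr; apply: continuous_comp; last exact: continuous_expR.
by apply: cvgMr; apply: cvgB; [exact: cvg_id|exact: cvg_cst].
Qed.

(* Integrating |g| <= c K phi against the weight phi(t) = exp(2 c |t - s|) gains a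
   factor 1/2, in both time directions: the Picard map is a contraction on the
   whole half line. *)
Lemma weighted_increment_le (R : realType) (p q : nat)
    (W g : R -> 'M[R]_(p, q)) (c K s : R) :
  0 <= s -> 0 < c -> 0 <= K -> has_derivative W g -> W s = 0 ->
  {ae @lebesgue_measure R, forall r, 0 < r ->
     `|g r| <= c * (K * expR (2 * c * `|r - s|))} ->
  forall t, 0 <= t -> `|W t| <= K / 2 * expR (2 * c * `|t - s|).
Proof.
move=> s0 c0 K0 Wg Ws gK t t0.
have [st|ts] := leP s t.
- have := @has_derivative_increment_le _ _ _ W g _ _ s t Wg s0 st
    (is_derive_affine_expR (K / 2) (2 * c) 0 s) (@continuous_affine_expR _ _ _ _ _).
  rewrite Ws subr0 !mul0r !addr0 subrr mulr0 expR0 mulr1 => H.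
  apply: le_trans (H _ _) _.
  + by move=> r; rewrite addr0 !mulr_ge0 ?expR_ge0// ltW.
  + apply: ae_imp gK => r Hr sr _; rewrite addr0.
    apply: le_trans (Hr (le_lt_trans s0 sr)) _.
    by rewrite gtr0_norm ?subr_gt0// le_eqVlt; apply/orP; left; apply/eqP; field.
  + by rewrite ger0_norm ?subr_ge0// gerBl divr_ge0.
(* Backwards from [s] the weight decreases in [r], so amplitude and exponent both change sign; the
   derivative of the comparison function stays nonnegative. *)
- have := @has_derivative_increment_le _ _ _ W g _ _ t s Wg t0 (ltW ts)
    (is_derive_affine_expR (- (K / 2)) (- (2 * c)) 0 s)
    (@continuous_affine_expR _ _ _ _ _).
  rewrite Ws sub0r normrN !mul0r !addr0 subrr mulr0 expR0 mulr1 => H.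
  apply: le_trans (H _ _) _.
  + by move=> r; rewrite addr0 mulrNN !mulr_ge0 ?expR_ge0// ltW.
  + apply: ae_imp gK => r Hr tr rs; rewrite addr0.
    apply: le_trans (Hr (le_lt_trans t0 tr)) _.
    rewrite ler0_norm ?subr_le0// mulrNN mulNr -mulrN.
    by rewrite le_eqVlt; apply/orP; left; apply/eqP; field.
  + rewrite ltr0_norm ?subr_lt0// mulNr opprK mulNr -mulrN gerDr oppr_le0.
    by rewrite divr_ge0.
Qed.

Lemma ae_bounded_integrable (R : realType) (f : R -> R) (T K : R) :
  measurable_fun (`[0, T] : set R) f ->
  {ae @lebesgue_measure R, forall r, 0 < r -> r <= T -> `|f r| <= K} ->
  leb.-integrable `[0, T] (EFin \o f).
Proof.
move=> mf fK; apply/integrableP; split; first exact/measurable_EFinP.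
have mf0 : measurable_fun (`]0, T] : set R) f.
  exact/measurable_fun_itv_obnd_cbndP.
rewrite -integral_itv_obnd_cbnd; last first.
  by apply: measurableT_comp => //; exact/measurable_EFinP.
apply: (@le_lt_trans _ _ (\int[leb]_(x in `]0%R, T]) `|K|%R%:E)%E).
  apply: ae_ge0_le_integral => //.
  - by apply: measurableT_comp => //; exact/measurable_EFinP.
  - apply: ae_imp fK => x H; rewrite /= in_itv /= => /andP[x0 xT].
    by rewrite lee_fin (le_trans (H x0 xT))// ler_norm.
rewrite integral_cst//= lebesgue_measure_itv /=; case: ifP => _.
  by rewrite -EFinB -EFinM ltry.
by rewrite mule0 ltry.
Qed.

(** If [a] were positive, an Archimedean [N > A / a] would contradict [N * a <= 2 ^+ N * a <= A]. *)
Lemma le0_of_le_geometric (R : realType) (a A : R) :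
  (forall k, a <= A / 2 ^+ k) -> a <= 0.
Proof.
move=> aA; rewrite leNgt; apply/negP => a0.
have A0 : 0 <= A.
  by have := aA 0; rewrite expr0 divr1; exact/le_trans/ltW.
have := archi_boundP (divr_ge0 A0 (ltW a0)).
set N := Num.Def.archi_bound _.
apply/negP; rewrite -leNgt ler_pdivlMr//.
apply: (@le_trans _ _ (2 ^+ N * a)).
  by rewrite ler_pM2r// -natrX ler_nat ltnW// ltn_expl.
by rewrite mulrC -ler_pdivlMr ?exprn_gt0.
Qed.

(* The limit is the supremum of the nondecreasing sequence u k - 2 A / 2 ^+ k. *)
Lemma geometric_increment_limit (R : realType) (u : nat -> R) (A : R) :
  (forall k, `|u k.+1 - u k| <= A / 2 ^+ k) ->
  exists l, forall k, `|u k - l| <= 2 * A / 2 ^+ k.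
Proof.
move=> uA.
(* [b k] is the sum of [A / 2 ^+ j] over [j >= k], the total movement still allowed after index [k].
   Hence the intervals from [u k - b k] to [u k + b k] are nested. *)
pose b k := 2 * A / 2 ^+ k.
have bS k : b k.+1 = b k - A / 2 ^+ k.
  by rewrite /b exprS; field; rewrite expf_neq0.
have uA' k : u k - A / 2 ^+ k <= u k.+1 <= u k + A / 2 ^+ k.
  by have := uA k; rewrite ler_distl.
have lo_nd : {homo (fun k => u k - b k) : m k / (m <= k)%N >-> m <= k}.
  apply: homo_leq => [//|y x z|k]; first exact: le_trans.
  by rewrite bS; have /andP[] := uA' k; lra.
have up_ni : {homo (fun k => u k + b k) : m k / (m <= k)%N >-> k <= m}.
  apply: (homo_leq (r := fun x y => y <= x)) => [//|y x z|k].
    by move=> xy yz; exact: le_trans yz xy.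
  by rewrite bS; have /andP[] := uA' k; lra.
have b0 k : 0 <= b k.
  have := le_trans (normr_ge0 _) (uA k).
  by rewrite /b -mulrA; exact: mulr_ge0.
have lu m k : u m - b m <= u k + b k.
  apply: (@le_trans _ _ (u (maxn m k) - b (maxn m k))).
    by apply: lo_nd; rewrite leq_maxl.
  apply: (@le_trans _ _ (u (maxn m k) + b (maxn m k))).
    by have := b0 (maxn m k); lra.
  by apply: up_ni; rewrite leq_maxr.
pose E := range (fun k => u k - b k).
have E0 : E !=set0 by exists (u 0%N - b 0%N); exists 0%N.
have ubE k : ubound E (u k + b k) by move=> _ [m _ <-]; exact: lu.
exists (sup E) => k; rewrite ler_distl; apply/andP; split.
  by rewrite lerBlDr; apply: ge_sup => //; exact: ubE.
rewrite -lerBlDr; apply: ub_le_sup; first by exists (u 0%N + b 0%N); exact: ubE.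
by exists k.
Qed.

(** * Linear equations: existence of solutions by Picard iteration *)

Section linear_ode.
Context (R : realType) (n : nat) (M : R -> 'M[R]_n) (C : R).
Context (mM : forall i j, measurable_fun (`]0, +oo[ : set R) (fun t => M t i j)).
Context (MC : ae_le M C).

(** Just enough regularity to integrate [M u *m z u]. The limit of the Picard iterates is first
    known only to lie in this class; its absolute continuity comes later, from the fixed point
    equation. *)
Definition locally_bounded_measurable (z : R -> 'cV[R]_n) :=
  forall T, 0 <= T ->
    (forall i, measurable_fun (`[0, T] : set R) (fun t => z t i 0)) /\
    exists K, forall t, 0 <= t -> t <= T -> `|z t| <= K.

Lemma has_derivative_lbm (z g : R -> 'cV[R]_n) :
  has_derivative z g -> locally_bounded_measurable z.
Proof.
move=> zg T T0; split=> [i|]; first exact: has_derivative_measurable zg T0.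
by have [K _ HK] := has_derivative_bounded zg T0; exists K.
Qed.

Lemma ae_mulmx_norm_le (z : R -> 'cV[R]_n) :
  {ae @lebesgue_measure R, forall t, 0 < t ->
     `|M t *m z t| <= n%:R * C * `|z t|}.
Proof.
apply: ae_imp MC => t H t0; rewrite (le_trans (mulmx_norm_le _ _))//.
by rewrite ler_wpM2r// ler_wpM2l// H.
Qed.

Lemma integrable_mulmx (z : R -> 'cV[R]_n) (T : R) i j :
  locally_bounded_measurable z -> 0 <= T ->
  leb.-integrable `[0, T] (fun u => ((M u *m z u) i j)%:E).
Proof.
move=> zP T0; have [mz [K zK]] := zP T T0.
apply: (@ae_bounded_integrable _ _ _ (n%:R * `|C| * K)).
  rewrite (_ : (fun u => _) = fun u => \sum_k M u i k * z u k j); last first.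
    by apply/funext => u; rewrite mxE.
  apply: measurable_sum => k; apply: measurable_funM; last by rewrite (ord1 j).
  apply/measurable_fun_itv_obnd_cbndP; apply: measurable_funS (mM i k) => //.
  by move=> x /=; rewrite !in_itv /= andbT => /andP[].
apply: ae_imp (ae_mulmx_norm_le z) => t H t0 tT.
rewrite (le_trans (mx_entry_le _ _ _))// (le_trans (H t0))//.
rewrite -!mulrA ler_wpM2l// (le_trans (ler_wpM2r _ (ler_norm C)))//.
by rewrite ler_wpM2l// zK// ltW.
Qed.

(** The difference of two integrals from 0 is the oriented integral from [s] to [t], so one formula
    covers times before and after [s]. *)
Definition picard (s : R) (x : 'cV[R]_n) (z : R -> 'cV[R]_n) : R -> 'cV[R]_n :=
  fun t => \col_i (x i 0 + (Rintegral leb `[0, t] (fun u => (M u *m z u) i 0)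
                          - Rintegral leb `[0, s] (fun u => (M u *m z u) i 0))).

Lemma picard_has_derivative s x z : locally_bounded_measurable z ->
  has_derivative (picard s x z) (fun u => M u *m z u).
Proof.
move=> zP t t0 i j; split; first exact: integrable_mulmx.
by rewrite (ord1 j) !mxE set_itv1 Rintegral_set1; ring.
Qed.

Lemma picard_start s x z : picard s x z s = x.
Proof. by apply/colP => i; rewrite mxE subrr addr0. Qed.

End linear_ode.

(** In the supremum norm weighted by [1 / phi], the Picard map contracts by 1/2 on the whole half
    line. The iterates converge geometrically at each time, and the limit is a fixed point. *)
Lemma solution_through (R : realType) (n : nat) (M : R -> 'M[R]_n) (s : R)
    (x : 'cV[R]_n) :
  Linfty M -> 0 <= s ->
  exists2 z, has_derivative z (fun t => M t *m z t) & z s = x.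
Proof.
move=> /LinftyP[mM [C C0 MC]] s0.
(* [n%:R * C] is a Lipschitz constant of [z |-> M t *m z] for the maximum norm; adding 1 makes [c]
   positive in every dimension. *)
pose c := n%:R * C + 1.
have nC0 : 0 <= n%:R * C by rewrite mulr_ge0// ltW.
have c0 : 0 < c by rewrite /c; lra.
pose phi t := expR (2 * c * `|t - s|).
have phi0 t : 0 <= phi t by rewrite expR_ge0.
have phi1 t : 1 <= phi t by rewrite -expR0 ler_expR !mulr_ge0 // ltW.
(* [Y] and [Y'] stand for Picard images of [z] and [z']. This form serves both for consecutive
   iterates and for comparing the limit with them. *)
have contract (Y Y' z z' : R -> 'cV[R]_n) K :
    has_derivative Y (fun u => M u *m z u) ->
    has_derivative Y' (fun u => M u *m z' u) -> Y s = Y' s -> 0 <= K ->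
    (forall t, 0 <= t -> `|z t - z' t| <= K * phi t) ->
    forall t, 0 <= t -> `|Y t - Y' t| <= K / 2 * phi t.
  move=> Yz Yz' Ys K0 zz'.
  have YY' := has_derivativeB Yz Yz'.
  apply: (weighted_increment_le s0 c0 K0 YY'); first by rewrite Ys subrr.
  apply: ae_imp (ae_mulmx_norm_le MC (fun u => z u - z' u)) => t H t0.
  rewrite -mulmxBr (le_trans (H t0))//.
  by apply: ler_pM => //; [rewrite /c; lra|exact/zz'/ltW].
pose u k := iter k (picard M s x) (cst 0).
have uP k : locally_bounded_measurable (u k).
  elim: k => [|k IH]; last exact/has_derivative_lbm/(picard_has_derivative mM MC).
  move=> T T0; split=> [i|]; first by rewrite /u /=; exact: measurable_cst.
  by exists 0 => t _ _; rewrite /u /= normr0.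
have uS k : has_derivative (u k.+1) (fun t => M t *m u k t).
  exact: (picard_has_derivative mM MC).
have us k : u k.+1 s = x by exact: picard_start.
have du k t : 0 <= t -> `|u k.+1 t - u k t| <= `|x| * phi t / 2 ^+ k.
  elim: k t => [|k IH] t t0.
    rewrite expr0 divr1 subr0 (_ : u 1%N t = x).
      by rewrite ler_peMr.
    apply/colP => i; rewrite mxE.
    have I0 r : \int[leb]_(v in `[0, r]) ((M v *m cst 0 v) i 0) = 0.
      under eq_Rintegral do rewrite mulmx0 mxE.
      by rewrite Rintegral_cst// mul0r.
    by rewrite !I0 subrr addr0.
  have := contract (u k.+2) (u k.+1) _ _ (`|x| / 2 ^+ k) (uS k.+1) (uS k).
  rewrite !us => /(_ erefl).
  have -> : `|x| * phi t / 2 ^+ k.+1 = `|x| / 2 ^+ k / 2 * phi t.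
    by rewrite exprS; field; rewrite expf_neq0.
  move=> H; apply: H => // r r0.
  by rewrite mulrAC; exact: IH.
(* Limits are chosen entry by entry at each time; at negative times the value is immaterial. *)
have /choice[l Hl] : forall p : R * 'I_n, exists l, 0 <= p.1 -> forall k,
    `|u k p.1 p.2 0 - l| <= 2 * (`|x| * phi p.1) / 2 ^+ k.
  move=> [t i] /=; have [t0|t0] := leP 0 t; last by exists 0.
  have Hi k : `|u k.+1 t i 0 - u k t i 0| <= `|x| * phi t / 2 ^+ k.
    by apply: le_trans (du k t t0); rewrite -sub_mxE mx_entry_le.
  by have [l Hl] := geometric_increment_limit Hi; exists l.
pose z t : 'cV[R]_n := \col_i l (t, i).
have uz k t : 0 <= t -> `|u k t - z t| <= 2 * `|x| / 2 ^+ k * phi t.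
  move=> t0; apply: mx_norm_le => [|i j]; first by rewrite !mulr_ge0 ?invr_ge0 ?exprn_ge0.
  rewrite (ord1 j) sub_mxE [z t i 0]mxE (le_trans (Hl (t, i) t0 k))//=.
  by rewrite mulrA mulrAC.
have zP : locally_bounded_measurable z.
  move=> T T0; split=> [i|].
    apply: (@measurable_fun_cvg _ _ _ _ (fun k t => u k t i 0)).
      by move=> k; have [mu _] := uP k T T0.
    move=> t /=; rewrite in_itv /= => /andP[t0 _].
    have half1 : `|2^-1 : R| < 1 by rewrite gtr0_norm ?invr_gt0// invf_lt1// ltr1n.
    have /cvgrPdist_le cvg0 := cvg_geometric (2 * `|x| * phi t) half1.
    apply/cvgrPdist_le => e e0; apply: filterS (cvg0 e e0) => k /=.
    rewrite sub0r normrN => /(le_trans (ler_norm _)); apply: le_trans.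
    rewrite -sub_mxE (le_trans (mx_entry_le _ _ _))// distrC.
    by rewrite (le_trans (uz k t t0))// exprVn mulrAC.
  exists (2 * `|x| * expR (2 * c * (T + s))) => t t0 tT.
  have := uz 0%N t t0; rewrite /u /= sub0r normrN expr0 divr1.
  move=> /le_trans; apply; rewrite ler_wpM2l ?mulr_ge0// ler_expR.
  rewrite ler_wpM2l ?mulr_ge0// ?(ltW c0)// ler_norml; apply/andP; split; lra.
pose y := picard M s x z.
have yz' := picard_has_derivative mM MC s x zP.
have ys : y s = x by exact: picard_start.
(* The image [y] of the limit is compared with [z] through [u k.+1]: each of the two distances is at
   most [|x| / 2 ^+ k * phi t], for every [k]. *)
have yz t : 0 <= t -> z t = y t.
  move=> t0; apply/eqP; rewrite eq_sym -subr_eq0 -normr_le0.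
  apply: (@le0_of_le_geometric _ _ (2 * `|x| * phi t)) => k.
  have := contract y (u k.+1) z (u k) (2 * `|x| / 2 ^+ k) yz' (uS k).
  rewrite ys us => /(_ erefl) H.
  have {}H : `|y t - u k.+1 t| <= 2 * `|x| / 2 ^+ k / 2 * phi t.
    by apply: H => // r r0; rewrite distrC uz.
  have -> : y t - z t = (y t - u k.+1 t) + (u k.+1 t - z t) by rewrite addrA subrK.
  rewrite (le_trans (ler_normD _ _))// (le_trans (lerD H (uz k.+1 t t0)))//.
  rewrite le_eqVlt; apply/orP; left; apply/eqP.
  by rewrite exprS; field; rewrite expf_neq0.
exists y => //; apply: eq_has_derivative yz' => // t t0.
by rewrite yz.
Qed.

(** * Robustness of exponential stability *)

(** Meant for the difference of a perturbed and an unperturbed solution that agree at [s]. For fixed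
    [T] the bound is linear in the forcing [al], hence small with the perturbation. *)
Lemma gronwall_window (R : realType) (p q : nat) (W g : R -> 'M[R]_(p, q))
    (c al s T : R) :
  0 <= s -> 0 <= T -> 0 < c -> 0 <= al -> has_derivative W g -> W s = 0 ->
  {ae @lebesgue_measure R, forall r, s < r -> r <= s + T ->
     `|g r| <= c * `|W r| + al} ->
  forall t, s <= t -> t <= s + T -> `|W t| <= 2 * al * T * expR (2 * c * T).
Proof.
move=> s0 T0 c0 al0 Wg Ws gW.
have [C C0 WC] := has_derivative_bounded Wg (addr_ge0 s0 T0).
(* With w = |W| exp(-2 c (. - s)) and K = sup w, integration gives
   K <= K / 2 + al T. *)
pose w r := `|W r| * expR (- (2 * c * (r - s))).
pose E := [set w r | r in [set r | s <= r <= s + T]].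
have expN1 r : s <= r -> expR (- (2 * c * (r - s))) <= 1.
  by move=> sr; rewrite -expR0 ler_expR oppr_le0 !mulr_ge0 ?subr_ge0// ltW.
have wE r : `|W r| = w r * expR (2 * c * (r - s)).
  by rewrite /w -mulrA -expRD addNr expR0 mulr1.
have E0 : E !=set0 by exists (w s); exists s => //=; rewrite lexx lerDl.
(* The supremum must be finite for the term [K / 2] to be absorbed into the left-hand side. *)
have Eub : has_ubound E.
  exists C => _ [r /andP[sr rT] <-]; rewrite /w -[leRHS]mulr1.
  by apply: ler_pM => //; [apply: WC => //; exact: le_trans sr|exact: expN1].
pose K := sup E.
have wK r : s <= r -> r <= s + T -> w r <= K.
  by move=> sr rT; apply: ub_le_sup => //; exists r => //=; rewrite sr.
have K0 : 0 <= K.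
  apply: le_trans (wK s _ _); rewrite ?lexx ?lerDl//.
  by rewrite /w mulr_ge0 ?expR_ge0.
have Wt t : s <= t -> t <= s + T ->
    `|W t| <= K / 2 * expR (2 * c * (t - s)) + al * T.
  move=> st tT.
  have := @has_derivative_increment_le _ _ _ W g _ _ s t Wg s0 st
    (is_derive_affine_expR (K / 2) (2 * c) al s) (@continuous_affine_expR _ _ _ _ _).
  rewrite Ws subr0 subrr mulr0 expR0 mulr1 => H; apply: le_trans (H _ _) _.
  - by move=> r; rewrite addr_ge0// !mulr_ge0 ?expR_ge0// ltW.
  - apply: ae_imp gW => r Hr sr rt; have rT := le_trans rt tT.
    apply: le_trans (Hr sr rT) _; rewrite lerD2r wE.
    rewrite (_ : K / 2 * (2 * c) = c * K); last by field.
    by rewrite -[leRHS]mulrA ler_pM2l// ler_wpM2r ?expR_ge0// wK// ltW.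
  - have : al * (t - s) <= al * T by rewrite ler_wpM2l// lerBlDl.
    by rewrite mulrBr; lra.
have K2 : K <= 2 * al * T.
  suff : K <= K / 2 + al * T by lra.
  apply: ge_sup => // _ [r /andP[sr rT] <-]; rewrite /w.
  apply: le_trans (ler_wpM2r (expR_ge0 _) (Wt r sr rT)) _.
  rewrite mulrDl -[X in X + _]mulrA -expRD addrN expR0 mulr1 lerD2l.
  by rewrite ler_piMr ?mulr_ge0// expN1.
move=> t st tT; rewrite wE; apply: ler_pM; rewrite ?expR_ge0//.
- by rewrite /w mulr_ge0 ?expR_ge0.
- exact: le_trans (wK t st tT) K2.
- rewrite ler_expR ler_wpM2l// ?lerBlDl//.
  by rewrite mulr_ge0// ltW.
Qed.

(** With [k] the integer part of [(t - s) / T], the [k] full windows give [expR (- k%:R)] and the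
    remaining piece costs [G]. Since [k > (t - s) / T - 1], rounding costs the factor [expR 1]. *)
Lemma window_decay (R : realType) (f : R -> R) (G T : R) :
  0 < T -> 0 <= G -> (forall t, 0 <= f t) ->
  (forall s t, 0 <= s -> s <= t -> t <= s + T -> f t <= G * f s) ->
  (forall s, 0 <= s -> f (s + T) <= expR (- 1) * f s) ->
  forall s t, 0 <= s -> s <= t ->
    f t <= G * expR 1 * expR (- T^-1 * (t - s)) * f s.
Proof.
move=> T0 G0 f0 fG fT s t s0 st.
have iter_decay k : f (s + k%:R * T) <= expR (- k%:R) * f s.
  elim: k => [|k IH]; first by rewrite mul0r addr0 oppr0 expR0 mul1r.
  have -> : s + k.+1%:R * T = s + k%:R * T + T by rewrite -natr1; ring.
  rewrite (le_trans (fT _ _))// ?addr_ge0 ?mulr_ge0// ?(ltW T0)//.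
  have -> : expR (- k.+1%:R) = expR (- 1) * expR (- k%:R) :> R.
    by rewrite -expRD -natr1; congr expR; ring.
  by rewrite -mulrA ler_wpM2l ?expR_ge0.
have q0 : 0 <= (t - s) / T by rewrite divr_ge0 ?subr_ge0// ltW.
pose k := Num.truncn ((t - s) / T).
have /andP[] := truncn_itv q0; rewrite -/k => kq qk.
have le1 : s + k%:R * T <= t by rewrite -lerBrDl -ler_pdivlMr.
have le2 : t <= s + k%:R * T + T.
  rewrite -addrA -lerBlDl; apply: ltW; rewrite ltr_pdivrMr// -natr1 in qk.
  by rewrite mulrDl mul1r in qk.
have sk0 : 0 <= s + k%:R * T by rewrite addr_ge0// mulr_ge0// ltW.
rewrite (le_trans (fG _ _ sk0 le1 le2))// -!mulrA ler_wpM2l//.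
rewrite (le_trans (iter_decay k))// mulrA ler_wpM2r// -expRD ler_expR.
by rewrite mulNr [T^-1 * _]mulrC -natr1 in qk *; lra.
Qed.

Lemma perturbed_exponentially_stable (R : realType) (n : nat) (D lambda : R)
    (M0 : R -> 'M[R]_n) :
  1 <= D -> 0 < lambda -> stable D lambda M0 ->
  exists2 delta : R, 0 < delta & forall M : R -> 'M[R]_n, Linfty M ->
    ae_le (fun t => M t - M0 t) delta -> exponentially_stable M.
Proof.
move=> D1 l0 [LM0 sM0].
have [_ [C C0 M0C]] := (LinftyP M0).1 LM0.
(* The stability constant for the maximum norm; [n.+1] instead of [n] keeps it at least 1 in every
   dimension. *)
pose D' := n.+1%:R * D.
have D'1 : 1 <= D' by rewrite /D' -[leLHS]mulr1 ler_pM// ler1n.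
have D'0 : 0 <= D' := le_trans ler01 D'1.
have stab (z : R -> 'cV[R]_n) s t : has_derivative z (fun u => M0 u *m z u) -> 0 <= s -> s <= t ->
    `|z t| <= D' * expR (- lambda * (t - s)) * `|z s|.
  move=> dz s0 st; rewrite (le_trans (mx_norm_le_enorm _))//.
  rewrite (le_trans (sM0 (z 0) z (conj dz erefl) s t s0 st))//.
  rewrite /D' [n.+1%:R * D]mulrC -!mulrA ler_wpM2l//; first lra.
  rewrite mulrCA ler_wpM2l ?expR_ge0// (le_trans (enorm_le_mx_norm _))//.
  by rewrite ler_wpM2r// ler_nat.
clearbody D'.
(* At the end of a window, [z] and [y - z] may each use half of the factor [expR (- 1)]. *)
pose ka : R := expR (- 1) / 2.
have ka0 : 0 < ka by rewrite divr_gt0// expR_gt0.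
have ka1 : ka <= 1.
  by rewrite /ka ler_pdivrMr// mul1r (@le_trans _ _ (expR 0)) ?ler_expR ?expR0; lra.
(* Chosen so that [expR (lambda * T) >= 1 + lambda * T >= D' / ka]. *)
pose T := D' / (ka * lambda).
have T0 : 0 < T by rewrite divr_gt0 ?mulr_gt0//; lra.
have DT : D' * expR (- (lambda * T)) <= ka.
  rewrite expRN ler_pdivrMr ?expR_gt0// -ler_pdivrMl//.
  apply: le_trans (expR_ge1Dx _).
  have -> : lambda * T = ka^-1 * D'.
    by rewrite /T; field; rewrite !gt_eqF.
  by rewrite lerDr.
clearbody T.
(* The growth constant of the perturbed equation: [|M t| <= C + 1] almost everywhere, because the
   perturbation will be at most 1. *)
pose c := n%:R * (C + 1) + 1.
have c0 : 0 < c by rewrite /c ltr_wpDl// mulr_ge0//; lra.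
(* With forcing [n%:R * de * (D' * |y s|)], the Gronwall bound is [de * Ga * |y s|]. The next choice
   of [de] makes both [de <= 1] and [de * Ga <= ka]. *)
pose Ga := 2 * (n%:R * D') * T * expR (2 * c * T).
have Ga0 : 0 <= Ga by rewrite /Ga !mulr_ge0 ?expR_ge0 ?(ltW T0).
pose de := ka / (Ga + 1).
have de0 : 0 < de by rewrite divr_gt0//; lra.
have de1 : de <= 1 by rewrite /de ler_pdivrMr ?mul1r; lra.
have deGa : de * Ga <= ka.
  rewrite /de mulrAC ler_pdivrMr ?ler_wpM2l//; last by lra.
  by rewrite ltW//; lra.
  by lra.
clearbody de.
exists de => // M LM Mde.
have window (y : R -> 'cV[R]_n) s : has_derivative y (fun u => M u *m y u) -> 0 <= s ->
    exists2 z, has_derivative z (fun u => M0 u *m z u) & z s = y s /\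
      forall t, s <= t -> t <= s + T -> `|y t - z t| <= ka * `|y s|.
  move=> dy s0; have [z dz zs] := solution_through (y s) LM0 s0.
  exists z => //; split=> // t st tT.
  have al0 : 0 <= n%:R * de * (D' * `|y s|) by rewrite !mulr_ge0 ?(ltW de0).
  have ys : y s - z s = 0 by rewrite zs subrr.
  have := @gronwall_window _ _ _ _ _ c _ s T s0 (ltW T0) c0 al0
    (has_derivativeB dy dz) ys.
  move=> H; apply: le_trans (H _ t st tT) _; last first.
    rewrite (_ : _ * expR _ = de * Ga * `|y s|); last by rewrite /Ga; ring.
    by rewrite ler_wpM2r.
  apply: ae_imp2 M0C Mde => r HC Hd sr rT.
  have r0 := le_lt_trans s0 sr.
  (* The perturbation is made to act on [z], which stability already bounds by [D' * |y s|], and not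
     on the unknown [y]. *)
  have -> : M r *m y r - M0 r *m z r =
      M r *m (y r - z r) + (M r - M0 r) *m z r.
    by rewrite mulmxBr mulmxBl addrA subrK.
  rewrite (le_trans (ler_normD _ _))// lerD//.
    rewrite (le_trans (mulmx_norm_le _ _))// ler_wpM2r//.
    have -> : M r = M0 r + (M r - M0 r) by rewrite addrC subrK.
    have MC : `|M0 r + (M r - M0 r)| <= C + 1.
      by rewrite (le_trans (ler_normD _ _))// lerD ?HC// (le_trans (Hd r0)).
    by rewrite (le_trans (ler_wpM2l _ MC))// /c lerDl.
  rewrite (le_trans (mulmx_norm_le _ _))//; apply: ler_pM => //.
    by rewrite ler_wpM2l// Hd.
  rewrite (le_trans (stab z s r dz s0 (ltW sr)))// zs ler_wpM2r//.
  rewrite ler_piMr//.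
  by rewrite -expR0 ler_expR mulNr oppr_le0 mulr_ge0 ?subr_ge0 ?ltW.
(* Inside a window, [z] contributes [D'] and [y - z] contributes [ka <= 1]. *)
pose G := D' + 1.
have G0 : 0 <= G by rewrite /G; lra.
exists (n.+1%:R * (G * expR 1)), T^-1; split.
- rewrite -[leLHS]mulr1 ler_pM ?ler1n// -[leLHS]mulr1 ler_pM//; first by rewrite /G; lra.
  by rewrite -expR0 ler_expR.
- by rewrite invr_gt0.
split=> // y0 y [dy _] s t s0 st.
have := @window_decay _ (fun t => `|y t|) G T T0 G0 (fun t => normr_ge0 _).
move=> H; have {}H := H _ _ s t s0 st.
rewrite (le_trans (enorm_le_mx_norm _))//.
apply: (@le_trans _ _ (n.+1%:R * `|y t|)); first by rewrite ler_wpM2r// ler_nat.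
rewrite -!mulrA ler_wpM2l//; move: H; rewrite -!mulrA => H.
apply: le_trans (H _ _) _.
- move=> {s t s0 st H} s t s0 st tT; have [z dz [zs yz]] := window y s dy s0.
  have -> : y t = z t + (y t - z t) by rewrite addrC subrK.
  rewrite (le_trans (ler_normD _ _))// /G mulrDl mul1r lerD//; last first.
    by rewrite (le_trans (yz t st tT))// ler_piMl.
  rewrite (le_trans (stab z s t dz s0 st))// zs ler_wpM2r//.
  rewrite ler_piMr//.
  by rewrite -expR0 ler_expR mulNr oppr_le0 mulr_ge0 ?subr_ge0 ?(ltW l0).
- move=> {s t s0 st H} s s0; have [z dz [zs yz]] := window y s dy s0.
  have sT : s <= s + T by rewrite lerDl ltW.
  have -> : y (s + T) = z (s + T) + (y (s + T) - z (s + T)) by rewrite [RHS]addrC subrK.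
  rewrite (le_trans (ler_normD _ _))//.
  have -> : expR (- 1) * `|y s| = ka * `|y s| + ka * `|y s| by rewrite /ka; field.
  rewrite lerD// ?yz// (le_trans (stab z s _ dz s0 sT))// zs ler_wpM2r//.
  by rewrite [s + T]addrC addrK mulNr.
- by rewrite !ler_wpM2l ?expR_ge0// mx_norm_le_enorm.
Qed.

(** * Uniformity over the compact parameter set *)

Lemma Linfty_subM (R : realType) (n : nat) (N : 'M[R]_n) (A P : R -> 'M[R]_n) :
  Linfty A -> Linfty P -> Linfty (fun t => A t - N *m P t).
Proof.
move=> /LinftyP[mA [a a0 Aa]] /LinftyP[mP [p p0 Pp]]; apply/LinftyP; split.
  move=> i j; rewrite (_ : (fun t => _) =
      fun t => A t i j - \sum_k N i k * P t k j); last first.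
    by apply/funext => t; rewrite sub_mxE [(_ *m _) i j]mxE.
  apply: measurable_funB => //; apply: measurable_sum => k.
  by apply: measurable_funM => //; exact: measurable_cst.
exists (a + n%:R * `|N| * p).
  by rewrite ltr_wpDr// !mulr_ge0// ltW.
apply: ae_imp2 Aa Pp => t HA HP t0.
rewrite (le_trans (ler_normB _ _))// lerD ?HA// (le_trans (mulmx_norm_le _ _))//.
by rewrite ler_wpM2l ?mulr_ge0// HP.
Qed.

Lemma Linfty_continuous_on_ball (R : realType) (s p q : nat) (S : set 'rV[R]_s)
    (F : 'rV[R]_s -> R -> 'M[R]_(p, q)) (sigma : 'rV[R]_s) (de : R) :
  Linfty_continuous_on S F -> S sigma -> 0 < de ->
  exists2 r : R, 0 < r & forall tau, S tau -> `|sigma - tau| < r ->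
    ae_le (fun t => F tau t - F sigma t) de.
Proof.
move=> cF Ss de0.
have /nbhs_ballP[r /= r0 Hr] :=
  cF sigma Ss _ (nbhs_open_ereal_lt (f := cst de) de0); exists r => // tau St tr.
apply/Linfty_normP; first exact: ltW.
by apply: ltW; apply: Hr => //; rewrite -ball_normE.
Qed.

Unset Implicit Arguments.

Theorem lemma3p9 (R : realType) (n m s : nat)
    (n_gt0 : (0 < n)%N) (m_gt0 : (0 < m)%N) (s_gt0 : (0 < s)%N)
    (S : set 'rV[R]_s) (S_compact : compact S)
    (B : 'M[R]_(n, m))
    (H : completeNormedModType R) (ip : H -> H -> R)
    (ip_inner : inner_product ip)
    (Q : {linear 'cV[R]_n -> H}) (Q_bounded : continuous Q)
    (A : 'rV[R]_s -> R -> 'M[R]_n) (rho : 'rV[R]_s -> R)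
    (A_Linfty : forall sigma, S sigma -> Linfty (A sigma))
    (rho_gt0 : forall sigma, S sigma -> 0 < rho sigma)
    (A_periodic : forall sigma, S sigma ->
      {ae @lebesgue_measure R, forall t : R,
        0 < t -> A sigma (t + rho sigma) = A sigma t})
    (A_stabilizable : forall sigma, S sigma ->
      exponentially_stabilizable (A sigma) B)
    (A_detectable : forall sigma, S sigma ->
      exponentially_detectable (A sigma) Q)
    (A_continuous : Linfty_continuous_on S A)
    (Pi : 'rV[R]_s -> R -> 'M[R]_n)
    (Pi_riccati : forall sigma, S sigma ->
      periodic_riccati_solution ip (A sigma) B Q (rho sigma) (Pi sigma))
    (Pi_continuous : Linfty_continuous_on S Pi)
    (closed_loop_stable : exists D lambda : R, [/\ 1 <= D, 0 < lambda &
      forall sigma, S sigma ->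
        stable D lambda (fun t => A sigma t - B *m B^T *m Pi sigma t)]) :
  exists2 eps : R, 0 < eps &
    forall sigma varsigma : 'rV[R]_s, S sigma -> S varsigma ->
      enorm (sigma - varsigma) < eps ->
      exponentially_stable (fun t => A sigma t - B *m B^T *m Pi varsigma t).
Proof.
have [D [lambda [D1 l0 stab]]] := closed_loop_stable.
have Pi_Linfty sigma : S sigma -> Linfty (Pi sigma).
  by move=> /Pi_riccati[].
pose P eps (tau : 'rV[R]_s) := forall varsigma, S varsigma ->
  enorm (tau - varsigma) < eps ->
  exponentially_stable (fun t => A tau t - B *m B^T *m Pi varsigma t).
(* Compactness as near-covering: if [P eps tau] holds for all [tau] in [S] near each [sigma] and all
   [eps] near 0 from the right, then a single [eps] serves all of [S]. *)
have cov := (near_covering_withinP S).2 ((compact_near_coveringP S).1 S_compact).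
suff [eps [eps0 epsP]] : exists eps, 0 < eps /\ S `<=` P eps.
  by exists eps => // sigma varsigma Ss; exact: epsP.
suff near_eps : \forall eps \near (0 : R)^'+, S `<=` P eps.
  have [eps [eps0 epsP]] := filter_ex (filterI (nbhs_right_gt (0 : R)) near_eps).
  by exists eps.
apply: cov => sigma Ss.
have [de de0 Hde] := perturbed_exponentially_stable D1 l0 (stab sigma Ss).
(* A positive Lipschitz constant of left multiplication by [B *m B^T]. The tolerance [de] is shared
   equally between the variations of [A] and of [B *m B^T *m Pi]. *)
pose k := n%:R * `|B *m B^T| + 1.
have k0 : 0 < k by rewrite /k ltr_wpDl// mulr_ge0.
have [r1 r10 H1] := Linfty_continuous_on_ball A_continuous Ss (divr_gt0 de0 (ltr0n R 2)).
have [r2 r20 H2] := Linfty_continuous_on_ball Pi_continuous Ss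
  (divr_gt0 (divr_gt0 de0 (ltr0n R 2)) k0).
(* [varsigma] is reached from [sigma] through [tau], so each of the two distances gets half of
   [r2]. *)
pose r := Num.min r1 (r2 / 2).
have r0 : 0 < r by rewrite lt_min r10 divr_gt0.
exists (ball sigma r, [set e | e < r]).
  split=> /=; first exact: nbhsx_ballx.
  exact: nbhs_right_lt.
move=> [tau e] /= [+ er] St varsigma Sv tv; rewrite -ball_normE /= lt_min => /andP[t1 t2].
(* Both [A tau] and [Pi varsigma] are compared with their values at the centre [sigma], so the
   tolerance [de] depends on [sigma] alone. *)
apply: Hde; first by apply: Linfty_subM; [exact: A_Linfty|exact: Pi_Linfty].
have v2 : `|sigma - varsigma| < r2.
  have -> : sigma - varsigma = (sigma - tau) + (tau - varsigma) by rewrite addrA subrK.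
  rewrite (le_lt_trans (ler_normD _ _))// [r2]splitr ltrD//.
  rewrite (le_lt_trans (mx_norm_le_enorm _))// (lt_trans tv)// (lt_le_trans er)//.
  by rewrite ge_min lexx orbT.
apply: ae_imp2 (H1 tau St t1) (H2 varsigma Sv v2) => t HA HP t0.
have -> : A tau t - B *m B^T *m Pi varsigma t -
    (A sigma t - B *m B^T *m Pi sigma t) =
    (A tau t - A sigma t) - B *m B^T *m (Pi varsigma t - Pi sigma t).
  by rewrite mulmxBr !opprB addrACA [RHS]addrACA [- A sigma t + _]addrC.
rewrite (le_trans (ler_normB _ _))// [de]splitr lerD ?HA//.
rewrite (le_trans (mulmx_norm_le _ _))//.
apply: (@le_trans _ _ (k * (de / 2 / k))); last by rewrite mulrC divfK// gt_eqF.
by apply: ler_pM; rewrite ?mulr_ge0// ?HP// /k lerDl.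
Qed.
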